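(* If $X$ is a first-countable compact space with a dense set of isolated points, then the countably infinite power $X^{\mathbb{N}}$ (with the product topology) is $h$-homogeneous and non-reconstructible.
   Context: A space $Y$ is $h$-homogeneous if every non-empty clopen subset of $Y$ is homeomorphic to $Y$. For a topological space $Y$, $[W]$ denotes the homeomorphism class of $W$, and the deck of $Y$ is the set $\mathcal{D}(Y)=\{[Y\setminus\{y\}] : y\in Y\}$. The space $Y$ is reconstructible if every topological space $Z$ with $\mathcal{D}(Z)=\mathcal{D}(Y)$ is homeomorphic to $Y$; it is non-reconstructible otherwise.
   Formalization: ''Compact'' is taken to mean compact Hausdorff (the claim fails for the Sierpinski space), and non-reconstructibility is stated only for X with at least two points (the empty and one-point spaces are reconstructible). *)

(* Defs.v *)
From HB Require Import structures.
From mathcomp Require Import all_boot.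
From mathcomp Require Import all_classical topology function_spaces.

Set Implicit Arguments.
Unset Strict Implicit.
Unset Printing Implicit Defensive.

Local Open Scope classical_set_scope.

Definition first_countable (T : topologicalType) : Prop :=
  forall x : T, exists B : set (set T),
    [/\ countable B,
        B `<=` nbhs x
      & forall V, nbhs x V -> exists2 U, B U & U `<=` V].

Definition homeomorphic (S T : topologicalType) : Prop :=
  exists (f : S -> T) (g : T -> S),
    [/\ cancel f g, cancel g f, continuous f & continuous g].

(* A subset A : set Y used as a type is [set_type A], which the library equips
   with the subspace topology. *)
Definition h_homogeneous (Y : topologicalType) : Prop :=
  forall A : set Y, clopen A -> A !=set0 ->
    homeomorphic (A : topologicalType) Y.

(* Classes and decks are bare predicates: [set topologicalType] would be a
   universe inconsistency. *)
Definition homeo_class (W : topologicalType) : topologicalType -> Prop :=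
  fun V => homeomorphic V W.

Definition deck (Y : topologicalType) : (topologicalType -> Prop) -> Prop :=
  fun C => exists y : Y, C = homeo_class (~` [set y] : set Y).

(* Z ranges over arbitrary topological spaces: no separation axiom, and
   possibly empty. *)
Definition reconstructible (Y : topologicalType) : Prop :=
  forall Z : topologicalType, deck Z = deck Y -> homeomorphic Z Y.

(* Main.v *)
Require Import Defs.
From mathcomp Require Import all_boot.
From mathcomp Require Import all_classical topology function_spaces.

Local Open Scope classical_set_scope.

(** Write [Y] for the countable power of [X].  The isolated points of [X] give
    many clopen cylinders of [Y]: for a finite word [s] of isolated points, the
    set of sequences that begin with [s] is clopen, it is a copy of [Y] (delete
    [s]), and every non-empty open set contains such a cylinder.

    The power is h-homogeneous.  Let [A] be clopen and non-empty, take a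
    cylinder of a non-empty word [s] inside [A], and let [f] prepend [s] to a
    sequence.  As in the proof of the Cantor-Bernstein theorem, apply [f] on the
    union of the sets [f^k (~` A)] and the identity elsewhere: this is a
    bijection from [Y] onto [A].  In general this map need not be continuous,
    because an infinite union of clopen sets need not be closed; here the sets
    [f^k (~` A)] shrink to the single point [q = s s s ...], which [f] fixes, so
    the two halves of the map agree at the only point where they meet
    ([clopen_homeomorphic_shrinking], [h_homogeneous_power]).

    The power is not reconstructible.  The candidate with the same deck is the
    sum of countably many copies of [Y], that is [nat * Y]; it is not compact,
    whereas [Y] is.  The decks agree because removing [(n, y)] from [nat * Y]
    gives the same space as removing [y] from [Y].  For this one needs pairwise
    disjoint clopen copies [B_0, B_1, ...] of [Y] in [Y] that converge to [y]:
    the complement of [y] can then absorb the countably many extra copies of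
    [Y], one piece each, as in Hilbert's hotel ([punctured_absorbs_copies]).
    The pieces are cylinders of words chosen with sequences [a_i] of isolated
    points converging to [y_i], which exist since [X] is first countable and
    its isolated points are dense ([punctured_power_pieces],
    [punctured_power_absorbs_copies]). *)

(** * Locally constant maps and continuity of piecewise maps *)

Definition locally_constant_at {S : topologicalType} {I : Type} (p : S -> I)
  (x : S) : Prop := \forall z \near x, p z = p x.

Lemma locally_constant_comp {S T : topologicalType} {I : Type} (f : S -> T)
    (p : T -> I) (x : S) :
  {for x, continuous f} -> locally_constant_at p (f x) ->
  locally_constant_at (p \o f) x.
Proof. by move=> cf lp; exact: cf lp. Qed.

Lemma locally_constant_op {S : topologicalType} {I J K : Type}
    (op : I -> J -> K) (p : S -> I) (p' : S -> J) (x : S) :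
  locally_constant_at p x -> locally_constant_at p' x ->
  locally_constant_at (fun z => op (p z) (p' z)) x.
Proof. by apply: filterS2 => z -> ->. Qed.

Lemma locally_constant_map {S : topologicalType} {I J : Type}
    (h : I -> J) (p : S -> I) (x : S) :
  locally_constant_at p x -> locally_constant_at (fun z => h (p z)) x.
Proof. by apply: filterS => z ->. Qed.

Lemma clopen_locally_constant {S : topologicalType} (A : set S) (x : S) :
  clopen A -> locally_constant_at A x.
Proof.
move=> [oA cA]; have [Ax|nAx] := pselect (A x).
  have : nbhs x A by exact: open_nbhs_nbhs.
  by apply: filterS => z Az; apply/propext.
have : nbhs x (~` A).
  by apply: open_nbhs_nbhs; split => //; exact: closed_openC.
by apply: filterS => z nAz; apply/propext.
Qed.

Lemma near_forall_ltn {S : topologicalType} (x : S) (P : nat -> set S)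
    (n : nat) :
  (forall i, (i < n)%N -> \forall z \near x, P i z) ->
  \forall z \near x, forall i, (i < n)%N -> P i z.
Proof.
elim: n => [|n IH] nP; first by apply: nearW.
have nPn := nP n (ltnSn n).
have /IH : forall i, (i < n)%N -> \forall z \near x, P i z.
  by move=> i ltin; apply: nP; exact: ltnW.
apply: filterS2 nPn => z Pnz Pz i; rewrite ltnS leq_eqVlt => /orP[/eqP->//|].
exact: Pz.
Qed.

Lemma piecewise_continuous_at {S T : topologicalType} {I : Type} (p : S -> I)
    (F : I -> S -> T) (x : S) :
  locally_constant_at p x -> {for x, continuous (F (p x))} ->
  {for x, continuous (fun z => F (p z) z)}.
Proof.
move=> lp cF U /cF nU; rewrite /nbhs /=.
by apply: filterS2 lp nU => z /= ->.
Qed.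

(** Near a frontier point of [C] both maps are in use; since they agree at that
    point, continuity of each of them is enough, however wild [C] is there. *)
Lemma patch_continuous {S T : topologicalType} (C : set S) (a b : S -> T) :
  continuous a -> continuous b ->
  (forall x, locally_constant_at C x \/ a x = b x) ->
  continuous (fun x => if `[< C x >] then a x else b x).
Proof.
move=> ca cb lC x; have [lCx|abx] := lC x.
  apply: (piecewise_continuous_at (fun z => `[< C z >])
            (fun (c : bool) z => if c then a z else b z)).
    exact: (locally_constant_map (fun P => `[< P >])).
  by case: asboolP => _; [exact: ca|exact: cb].
move=> U; rewrite abx if_same => nU.
have naU : nbhs x (a @^-1` U) by apply: ca; rewrite abx.
have nbU : nbhs x (b @^-1` U) by exact: cb.
by apply: filterS2 naU nbU => z aU bU /=; case: ifP.
Qed.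

(** * Homeomorphisms between subspaces *)

Lemma homeomorphic_sym (S T : topologicalType) :
  homeomorphic S T -> homeomorphic T S.
Proof. by move=> [f [g [fK gK cf cg]]]; exists g, f. Qed.

Lemma homeomorphic_trans (S T U : topologicalType) :
  homeomorphic S T -> homeomorphic T U -> homeomorphic S U.
Proof.
move=> [f [g [fK gK cf cg]]] [f' [g' [fK' gK' cf' cg']]].
exists (f' \o f), (g \o g'); split.
- exact: can_comp.
- exact: can_comp.
- by move=> x; apply: continuous_comp; [exact: cf|exact: cf'].
- by move=> x; apply: continuous_comp; [exact: cg'|exact: cg].
Qed.

Lemma subset_map_continuous {S T : topologicalType} (A : set S) (B : set T)
    (f : S -> T) (g : A -> B) :
  (forall x : A, set_val (g x) = f (set_val x)) ->
  (forall x, A x -> {for x, continuous f}) -> continuous g.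
Proof.
move=> gE cf; apply: continuous_comp_initial => x.
rewrite (_ : set_val \o g = f \o set_val); last exact/funext.
apply: continuous_comp; first exact: initial_continuous.
by apply: cf; exact: set_valP.
Qed.

(** Lets a homeomorphism of subspaces be given by total maps of the ambient
    spaces, continuous only at the points of the subspaces. *)
Lemma homeomorphic_subsets (S T : topologicalType) (A : set S) (B : set T)
    (f : S -> T) (g : T -> S) :
  (forall x, A x -> B (f x)) -> (forall y, B y -> A (g y)) ->
  (forall x, A x -> g (f x) = x) -> (forall y, B y -> f (g y) = y) ->
  (forall x, A x -> {for x, continuous f}) ->
  (forall y, B y -> {for y, continuous g}) ->
  homeomorphic A B.
Proof.
move=> AB BA gK fK cf cg.
pose F (x : A) : B := SigSub (mem_set (AB _ (set_valP x))).
pose G (y : B) : A := SigSub (mem_set (BA _ (set_valP y))).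
exists F, G; split.
- by move=> x; apply: val_inj; apply: gK; exact: set_valP.
- by move=> y; apply: val_inj; apply: fK; exact: set_valP.
- exact: (subset_map_continuous _ _ f).
- exact: (subset_map_continuous _ _ g).
Qed.

Lemma homeomorphic_setT (S : topologicalType) : homeomorphic [set: S] S.
Proof.
exists set_val, (fun x => SigSub (mem_set (I : [set: S] x))); split => //.
- by move=> x; apply: val_inj.
- exact: initial_continuous.
- by apply: continuous_comp_initial => x; exact: cvg_id.
Qed.

(** * A Cantor-Bernstein argument for shrinking clopen embeddings *)

Section ShrinkingEmbedding.
Variables (Y : topologicalType) (f d : Y -> Y) (q : Y) (A : set Y).
Hypotheses (f_cont : continuous f) (d_cont : continuous d) (fK : cancel f d).
Hypothesis fq : f q = q.
(* The range of [f]. *)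
Let R : set Y := [set x | f (d x) = x].
Hypothesis R_lc : forall x, locally_constant_at R x.
(* The iterated ranges [f^k (Y)] have no common point besides [q]. *)
Hypothesis R_shrinks : forall x, (forall k, R (iter k d x)) -> x = q.
Hypothesis A_clopen : clopen A.
Hypothesis RA : R `<=` A.

(** The union of the sets [f^k (~` A)]: the points that the bijection from [Y]
    onto [A] moves by [f]. *)
Inductive displaced : Y -> Prop :=
| displaced_out x : ~ A x -> displaced x
| displaced_step x : displaced x -> displaced (f x).

Let displacedE : displaced = [set x | ~ A x \/ R x /\ displaced (d x)].
Proof.
apply/seteqP; split=> x /=.
  case=> {}x; first by left.
  by move=> Cx; right; rewrite /R /= fK.
case=> [nAx|[Rx Cx]]; first exact: displaced_out.
by rewrite -Rx; exact: displaced_step.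
Qed.

(* A point outside [f^k (Y)] has a neighbourhood outside the closed set
   [f^k (Y)], where only the first [k] of the clopen sets [f^j (~` A)] count. *)
Let displaced_lc x : x <> q -> locally_constant_at displaced x.
Proof.
move=> xq; have /existsNP[k nRk] : ~ forall k, R (iter k d x).
  by move/R_shrinks.
elim: k x {xq} nRk => [|k IH] x.
  move=> /= nRx.
  have lA := @locally_constant_map _ _ _ not _ _
    (clopen_locally_constant _ x A_clopen).
  rewrite displacedE; move: (R_lc x) lA; apply: filterS2 => z Rz Az.
  by rewrite /= Rz Az; apply/propext; split=> -[|[]]; by [left|].
rewrite iterSr => /IH lC.
rewrite displacedE.
apply: (locally_constant_op or).
  by apply: locally_constant_map; exact: clopen_locally_constant.
apply: (locally_constant_op and) => //.
exact: (locally_constant_comp d displaced x (d_cont x)).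
Qed.

(** The Cantor-Bernstein bijection [g] and its inverse [h] are patches of
    continuous maps along sets that are clopen away from [q], and all these maps
    fix [q]. *)
Lemma clopen_homeomorphic_shrinking : homeomorphic A Y.
Proof.
apply: homeomorphic_trans (homeomorphic_setT Y).
have dq : d q = q by rewrite -{1}fq fK.
pose C' := [set x | R x /\ displaced (d x)].
pose g x := if `[< displaced x >] then f x else x.
pose h x := if `[< C' x >] then d x else x.
have cg : continuous g.
  apply: patch_continuous => // [x|x]; first exact: cvg_id.
  by have [->|/displaced_lc lx] := pselect (x = q); [right|left].
have ch : continuous h.
  apply: patch_continuous => // [x|x]; first exact: cvg_id.
  have [->|xq] := pselect (x = q); first by right.
  left.
  have [Rx|nRx] := pselect (R x).
    apply: (locally_constant_op and) => //.
    apply: (locally_constant_comp d displaced x (d_cont x)).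
    by apply: displaced_lc => dxq; apply: xq; rewrite -Rx dxq.
  by move: (R_lc x); apply: filterS => z Rz; rewrite /C' /= Rz; apply/propext;
    split=> -[].
apply: (homeomorphic_subsets _ _ _ _ h g) => //.
- move=> x _; rewrite /g; case: asboolP => [_|nC].
    by apply: RA; rewrite /R /= fK.
  by apply: contrapT => nA; apply: nC; left.
- move=> x Ax; rewrite /h; case: asboolP => [[Rx Cdx]|nC'].
    by rewrite /g asboolT.
  rewrite /g asboolF //; rewrite displacedE => -[//|]; exact: nC'.
- move=> x _; rewrite /g; case: asboolP => [Cx|nC].
    by rewrite /h asboolT ?fK // /C' /R /= fK.
  by rewrite /h asboolF // => C'x; apply: nC; rewrite displacedE; right.
- by move=> x _; exact: ch.
- by move=> x _; exact: cg.
Qed.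

End ShrinkingEmbedding.

(** * Absorbing countably many copies *)

Section Hotel.
Variables (Y : topologicalType) (y : Y) (p : Y -> option nat).
Variables (phi psi : nat -> Y -> Y).
(* [p] tells which piece [B_k] contains a point, and [phi k] is a homeomorphism
   from [Y] onto [B_k] with inverse [psi k]. *)
Hypothesis py : p y = None.
Hypothesis p_phi : forall k z, p (phi k z) = Some k.
Hypothesis phiK : forall k, cancel (phi k) (psi k).
Hypothesis psiK : forall k x, p x = Some k -> phi k (psi k x) = x.
Hypothesis phi_cont : forall k, continuous (phi k).
Hypothesis psi_cont : forall k, continuous (psi k).
(* The pieces are clopen and accumulate at most at [y]. *)
Hypothesis p_lc : forall x, x <> y -> locally_constant_at p x.

Variable n : nat.

(* The points of the complement of [y] go to the copy with index [n], except
   that the piece [2k] is spread over the piece [k] of that copy and the piece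
   [2k+1] becomes the [k]-th of the other copies, whose index is [bump n k]. *)
Let to_room (r : option nat) (x : Y) : nat * Y :=
  if r is Some k then
    if odd k then (bump n k./2, psi k x) else (n, phi k./2 (psi k x))
  else (n, x).

Let from_room (m : nat) (r : option nat) (z : Y) : Y :=
  if m == n then
    if r is Some k then phi k.*2 (psi k z) else z
  else phi (unbump n m).*2.+1 z.

Let F x := to_room (p x) x.
Let G w := from_room w.1 (p w.2) w.2.

Let FK x : G (F x) = x.
Proof.
rewrite /F /to_room; case px: (p x) => [k|].
  case: ifPn => ok; rewrite /G /from_room /=.
    rewrite eq_sym (negbTE (neq_bump _ _)) bumpK.
    by rewrite (_ : (k./2).*2.+1 = k) ?psiK // -[RHS]odd_double_half ok.
  rewrite eqxx p_phi phiK (_ : (k./2).*2 = k) ?psiK //.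
  by rewrite -[RHS]odd_double_half (negbTE ok).
by rewrite /G /from_room /= eqxx px.
Qed.

Let GK w : F (G w) = w.
Proof.
case: w => m z; rewrite /G /from_room /=; case: eqVneq => [->|mn].
  case pz: (p z) => [k|]; rewrite /F.
    by rewrite p_phi /= odd_double doubleK phiK psiK.
  by rewrite pz.
rewrite /F p_phi /= odd_double /= uphalf_double phiK unbumpK //.
Qed.

Let Fy : F y = (n, y).
Proof. by rewrite /F py. Qed.

(** Where [p] is locally constant, both maps of the hotel are locally given by
    one of the continuous formulas in their definition. *)
Lemma punctured_absorbs_copies : homeomorphic (~` [set y]) (~` [set (n, y)]).
Proof.
have F_inj : injective F := can_inj FK.
have G_inj : injective G := can_inj GK.
have Gy : G (n, y) = y by rewrite -Fy FK.
apply: (homeomorphic_subsets _ _ _ _ F G) => [x|w|x|w|x|w].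
- by move=> xy; rewrite /= -Fy => /F_inj.
- by move=> wy; rewrite /= -[in X in _ = X]Gy => /G_inj.
- by [].
- by [].
- move=> xy; apply: piecewise_continuous_at; first exact: p_lc.
  have cpair m (f : Y -> Y) : continuous f ->
      {for x, continuous (fun z => (m, f z) : nat * Y)}.
    by move=> cf; apply: (cvg_pair (cvg_cst m) (cf x)).
  rewrite /to_room; case: (p x) => [k|]; last first.
    by apply: (cpair n id) => z; exact: cvg_id.
  case: (odd k); first exact: cpair.
  apply: (cpair n (phi k./2 \o psi k)) => z.
  by apply: continuous_comp; [exact: psi_cont|exact: phi_cont].
- move=> wy.
  apply: (@piecewise_continuous_at _ _ _ fst
    (fun m w => from_room m (p w.2) w.2)).
    apply: (@locally_constant_comp _ _ _ fst id); first exact: cvg_fst.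
    exact: discrete_set1.
  have csnd (f : Y -> Y) : continuous f ->
      {for w, continuous (fun w : nat * Y => f w.2)}.
    by move=> cf; apply: continuous_comp; [exact: cvg_snd|exact: cf].
  rewrite /from_room; case: eqVneq => [wn|_]; last first.
    exact: csnd.
  apply: (@piecewise_continuous_at _ _ _ (fun w => p w.2)
    (fun r w => if r is Some k then phi k.*2 (psi k w.2) else w.2)).
    apply: (@locally_constant_comp _ _ _ snd p); first exact: cvg_snd.
    apply: p_lc => w2; apply: wy.
    by case: w wn w2 {csnd} => /= ? ? -> ->.
  case: (p w.2) => [k|]; last exact: cvg_snd.
  apply: (csnd (phi k.*2 \o psi k)) => x.
  by apply: continuous_comp; [exact: psi_cont|exact: phi_cont].
Qed.

End Hotel.

(** * Non-compactness of nat and sequences in first-countable spaces *)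

Lemma not_compact_nat : ~ compact [set: nat].
Proof.
move=> /(_ \oo _ filterT)[n [_ clu]].
have [m [/= nm mn]] := clu [set m | (n < m)%N] [set n] (nbhs_infty_gt n)
  (discrete_set1 n).
by move: nm; rewrite mn ltnn.
Qed.

(** A countable base at [x] is replaced by the decreasing sequence [V] of its
    finite intersections; any choice of points in [D `&` V k] converges. *)
Lemma closure_sequence {T : topologicalType} (D : set T) (x : T) :
  first_countable T -> closure D x ->
  exists a : nat -> T, (forall k, D (a k)) /\ a @ \oo --> x.
Proof.
move=> /(_ x)[B [/countable_injP[e e_inj] Bx Bbase]] Dx.
pose V k := [set z | forall U, B U -> (e U < k)%N -> U z].
have Vx k : nbhs x (V k).
  elim: k => [|k IH]; first by apply: filterS filterT => z _ U _.
  (* [e] is injective, so [V k.+1] adds at most one condition to [V k]. *)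
  have [[U0 BU0 eU0]|noU] := pselect (exists2 U, B U & e U = k).
    apply: filterS2 IH (Bx _ BU0) => z Vz U0z U BU; rewrite ltnS leq_eqVlt.
    move=> /orP[/eqP eU|]; last exact: Vz.
    by rewrite (e_inj U U0) ?inE // eU.
  apply: filterS IH => z Vz U BU; rewrite ltnS leq_eqVlt.
  by move=> /orP[/eqP eU|]; [case: noU; exists U|exact: Vz].
have /choice[a aP] k : exists z, D z /\ V k z by have := Dx _ (Vx k).
exists a; split=> [k|W /Bbase[U BU UW]]; first by have [] := aP k.
exists (e U).+1 => // k /= ltek; apply: UW.
by have [_] := aP k; apply.
Qed.

(** * Cylinders in the countable power *)

Section Words.
Variable X : topologicalType.
Implicit Types (n : nat) (s : nat -> X) (x y z : {ptws nat -> X}).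

Lemma ptws_continuous_at {S : topologicalType} (f : S -> {ptws nat -> X})
    (u : S) :
  (forall i, {for u, continuous (fun v => f v i)}) -> {for u, continuous f}.
Proof.
move=> cf; apply/cvg_sup => i U [V [[W oW <-] Wfu WU]].
apply: (filterS WU); apply: (cf i).
exact: open_nbhs_nbhs.
Qed.

Lemma eval_continuous i : continuous (fun x => x i).
Proof. exact: (@proj_continuous _ (fun=> X) i). Qed.

(** The sets containing such a box form a filter that converges to [x]
    coordinatewise, hence in the product topology. *)
Lemma nbhs_ptws (x : {ptws nat -> X}) (A : set {ptws nat -> X}) :
  nbhs x A -> exists (n : nat) (W : nat -> set X),
    (forall i, nbhs (x i) (W i)) /\
    (forall z : {ptws nat -> X}, (forall i, (i < n)%N -> W i (z i)) -> A z).
Proof.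
pose D := [set nW : nat * (nat -> set X) | forall i, nbhs (x i) (nW.2 i)].
pose cyl (nW : nat * (nat -> set X)) : set {ptws nat -> X} :=
  [set z | forall i, (i < nW.1)%N -> nW.2 i (z i)].
have FF : Filter (filter_from D cyl).
  apply: filter_from_filter.
    by exists (0, fun=> setT) => i; exact: filterT.
  move=> [n V] [m W] /= DV DW.
  exists (maxn n m, fun i => V i `&` W i) => [i|z cz].
    exact: filterI (DV i) (DW i).
  by split=> i ltin; have [] := cz i; rewrite //= leq_max ltin ?orbT.
have : filter_from D cyl --> x.
  apply/cvg_sup => i U [V [[W oW <-] Wfu WU]].
  exists (i.+1, fun j => if j == i then W else setT) => [j|z cz] /=.
    by case: eqP => [->|_]; [exact: open_nbhs_nbhs|exact: filterT].
  by apply: WU; have := cz i (ltnSn i); rewrite /= eqxx.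
by move=> /[apply] -[[n W] DW cW]; exists n, W.
Qed.

Definition splice n s z : {ptws nat -> X} :=
  fun i => if (i < n)%N then s i else z (i - n).

Definition drop_prefix n x : {ptws nat -> X} := fun i => x (n + i).

Lemma splice_continuous n s : continuous (splice n s).
Proof.
move=> z; apply: ptws_continuous_at => i; rewrite /splice.
have [_|_] := boolP (i < n)%N.
  exact: cst_continuous.
exact: (eval_continuous (i - n) z).
Qed.

Lemma drop_prefix_continuous n : continuous (drop_prefix n).
Proof.
by move=> z; apply: ptws_continuous_at => i; exact: (eval_continuous (n + i) z).
Qed.

Lemma spliceK n s : cancel (splice n s) (drop_prefix n).
Proof.
move=> z; apply/funext => i.
by rewrite /drop_prefix /splice ltnNge leq_addr /= addKn.
Qed.

Lemma splice_dropP n s x :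
  splice n s (drop_prefix n x) = x <-> forall i, (i < n)%N -> x i = s i.
Proof.
split=> [<- i ltin|xs]; first by rewrite /splice ltin.
apply/funext => i; rewrite /splice /drop_prefix; case: ltnP => [/xs//|leni].
by rewrite subnKC.
Qed.

Lemma isolated_nbhs (p : X) : isolated [set: X] p -> nbhs p [set p].
Proof. by move=> [_ [V Vp <-]]; rewrite setIT. Qed.

Hypothesis X_hausdorff : hausdorff_space X.

Lemma isolated_clopen (p : X) : isolated [set: X] p -> clopen [set p].
Proof.
move=> /isolated_nbhs np; split; last first.
  exact: accessible_closed_set1 (hausdorff_accessible X_hausdorff) p.
by rewrite openE => _ ->; exact: np.
Qed.

Lemma isolated_eval_locally_constant i (p : X) x : isolated [set: X] p ->
  locally_constant_at (fun z : {ptws nat -> X} => z i = p) x.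
Proof.
move=> ip; apply: (@locally_constant_comp _ _ _
  (fun z : {ptws nat -> X} => z i) [set p]).
  exact: eval_continuous.
by apply: clopen_locally_constant; exact: isolated_clopen.
Qed.

Lemma cylinder_locally_constant n s x :
  (forall i, (i < n)%N -> isolated [set: X] (s i)) ->
  locally_constant_at
    [set z : {ptws nat -> X} | forall i, (i < n)%N -> z i = s i] x.
Proof.
move=> is_s.
have := @near_forall_ltn _ x (fun i z => (z i = s i) = (x i = s i)) n.
move=> /(_ _)/wrap[i /is_s|]; first exact: isolated_eval_locally_constant.
apply: filterS => z zx; apply/propext.
by split=> h i /[dup] ltin /h; rewrite zx.
Qed.

Hypothesis X_isolated : dense (isolated [set: X]).

Lemma nbhs_isolated (p : X) (W : set X) :
  nbhs p W -> exists2 c, isolated [set: X] c & W c.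
Proof.
move=> nW; have [||c [Wc ic]] := X_isolated (interior W).
- by exists p; exact: nW.
- exact: open_interior.
- by exists c => //; exact: interior_subset.
Qed.

(** * Homogeneity *)

(** Prepending a word of isolated points whose cylinder lies in the clopen set
    is a shrinking embedding, with the periodic sequence as fixed point. *)
Lemma h_homogeneous_power : h_homogeneous {ptws nat -> X}.
Proof.
move=> A A_clopen [x Ax].
have /nbhs_ptws[n [W [Wx WA]]] : nbhs x A.
  by apply: open_nbhs_nbhs; split => //; exact: A_clopen.1.
have /choice[s sP] i : exists c, isolated [set: X] c /\ W i c.
  by have [c ic Wc] := nbhs_isolated _ _ (Wx i); exists c.
(* The word has length [n.+1]: with an empty word nothing would shrink. *)
pose q : {ptws nat -> X} := fun i => s (i %% n.+1).
apply: (@clopen_homeomorphic_shrinking _ (splice n.+1 s)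
  (drop_prefix n.+1) q) => //.
- exact: splice_continuous.
- exact: drop_prefix_continuous.
- exact: spliceK.
- apply/funext => i; rewrite /splice /q; case: ltnP => [ltin|lein].
    by rewrite modn_small.
  by rewrite -[in RHS](subnK lein) modnDr.
- move=> z; rewrite (_ : [set _ | _] =
    [set z : {ptws nat -> X} | forall i, (i < n.+1)%N -> z i = s i]).
    by apply: cylinder_locally_constant => i _; have [] := sP i.
  by apply/seteqP; split=> w /= /splice_dropP.
- move=> z Rz; apply/funext => i; rewrite /q.
  have iterE k j : iter k (drop_prefix n.+1) z j = z (k * n.+1 + j).
    elim: k j => [|k IH] j; first by rewrite mul0n.
    by rewrite iterS /drop_prefix IH addnA -mulSnr.
  rewrite {1}(divn_eq i n.+1) -iterE.
  by move/splice_dropP: (Rz (i %/ n.+1)); apply; rewrite ltn_mod.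
- move=> z /= /splice_dropP zs; apply: WA => i ltin.
  by rewrite zs; [have [] := sP i|exact: ltnW].
Qed.

(** * Deleting a point of the power *)

Hypothesis X_fc : first_countable X.

Section Pieces.
Variable x : {ptws nat -> X}.
Variables (a : nat -> nat -> X) (c : nat -> X).
Hypothesis a_isolated : forall i k, isolated [set: X] (a i k).
Hypothesis c_isolated : forall i, isolated [set: X] (c i).
Hypothesis a_cvg : forall i, a i @ \oo --> x i.
Hypothesis ac : forall i k, a i k <> c i.
Hypothesis xc : forall i, x i <> c i.

(* The [k]-th piece fixes the coordinates [0, ..., k].  The last letter [c k]
   keeps it away from [x], and away from the later pieces, whose letter at
   position [k] is taken from [a k]; the other letters make it close to [x]. *)
Let word k i := if i == k then c k else a i k.

Let piece k : set {ptws nat -> X} :=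
  [set z | forall i, (i < k.+1)%N -> z i = word k i].

Let piece_disjoint k l z : piece k z -> piece l z -> k = l.
Proof.
wlog: k l / (k < l)%N => [wlg|ltkl pk pl].
  by case: (ltngtP k l) => // lt pk pl; [exact: wlg|apply/esym; exact: wlg].
have := pk k (ltnSn k); rewrite pl /word; last exact: ltnW.
by rewrite eqxx (ltn_eqF ltkl) => /ac.
Qed.

Let piece_index z : exists r : option nat,
  if r is Some k then piece k z else forall k, ~ piece k z.
Proof.
have [[k pk]|nk] := pselect (exists k, piece k z); first by exists (Some k).
by exists None => k pk; apply: nk; exists k.
Qed.

(** The pieces accumulate only at [x]: a point [z] that differs from [x] at
    coordinate [i] has a neighbourhood whose [i]-th coordinates avoid [a i k]
    for large [k], so it meets only finitely many pieces. *)
Lemma punctured_power_pieces n :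
  homeomorphic (~` [set x]) (~` [set (n, x)]).
Proof.
have [p pP] := choice piece_index.
have p_piece k z : p z = Some k <-> piece k z.
  split=> [pz|pk]; first by have := pP z; rewrite pz.
  have := pP z; case: (p z) => [l pl|/(_ k)//].
  by rewrite (piece_disjoint _ _ _ pl pk).
apply: (@punctured_absorbs_copies _ x p (fun k => splice k.+1 (word k))
  (fun k => drop_prefix k.+1)) => [|k z|k|k z|k|k|z zx].
- case px: (p x) => [k|//]; move/p_piece: px => /(_ k (ltnSn k)).
  by rewrite /word eqxx => /xc.
- by apply/p_piece => i ltik; rewrite /splice ltik.
- exact: spliceK.
- by move=> /p_piece pk; apply/splice_dropP.
- exact: splice_continuous.
- exact: drop_prefix_continuous.
- have [i /eqP zxi] : exists i, z i <> x i.
    by apply/existsNP => zxE; apply: zx; exact/funext.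
  move: X_hausdorff; rewrite open_hausdorff => /(_ _ _ zxi)[[P Q] /= [Pz Qx]].
  move=> [oP oQ /eqP PQ].
  have /a_cvg[L _ aL] : nbhs (x i) Q.
    by apply: open_nbhs_nbhs; split => //; exact: set_mem.
  have nP : \forall w \near z, P (w i).
    apply: eval_continuous; apply: open_nbhs_nbhs; split => //; exact: set_mem.
  (* Only from [i.+1] on is the [i]-th letter of a word taken from [a i]. *)
  pose M := maxn L i.+1.
  have nM : \forall w \near z, forall k, (k < M)%N -> piece k w = piece k z.
    apply: near_forall_ltn => k _; apply: cylinder_locally_constant => j _.
    by rewrite /word; case: eqP.
  have big w k : P (w i) -> (M <= k)%N -> ~ piece k w.
    rewrite geq_max => Pw /andP[Lk ik] /(_ i (leqW ik)).
    rewrite /word (ltn_eqF ik) => wi; have : (P `&` Q) (w i).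
      by split => //; rewrite wi; exact: aL.
    by rewrite PQ.
  have pieceE w : P (w i) -> (forall k, (k < M)%N -> piece k w = piece k z) ->
      forall k, piece k w <-> piece k z.
    move=> Pw wM k; case: (ltnP k M) => [/wM -> //|Mk].
    by split=> h; [case: (big w k)|case: (big z k (nbhs_singleton nP))].
  apply: filterS2 nP nM => w Pw /(pieceE w Pw) {}pieceE.
  case pz: (p z) => [k|].
    by apply/p_piece/pieceE/p_piece.
  case pw: (p w) => [k|//].
  by move/p_piece/pieceE/p_piece: pw; rewrite pz.
Qed.

End Pieces.

(** Isolated points being dense, each [x i] is a limit of isolated points other
    than a chosen isolated point [c i <> x i]. *)
Lemma punctured_power_absorbs_copies (p q : X) n x : p <> q ->
  homeomorphic (~` [set x]) (~` [set (n, x)]).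
Proof.
move=> pq.
have T1 (u : X) : open (~` [set u]).
  rewrite openC.
  exact: accessible_closed_set1 (hausdorff_accessible X_hausdorff) u.
have /choice[c cP] i : exists c, isolated [set: X] c /\ c <> x i.
  have [u ux] : exists u, u <> x i.
    have [px|] := pselect (p = x i); last by exists p.
    by exists q => qx; apply: pq; rewrite px qx.
  have [||v [vx iv]] := X_isolated (~` [set x i]) => //; first by exists u.
  by exists v.
have /choice[a aP] i : exists a : nat -> X,
    (forall k, isolated [set: X] (a k) /\ a k <> c i) /\ a @ \oo --> x i.
  apply: (closure_sequence [set v | isolated [set: X] v /\ v <> c i]) => //.
  move=> W nW.
  have nWc : nbhs (x i) (W `&` ~` [set c i]).
    apply: filterI => //; apply: open_nbhs_nbhs; split => //= xc.
    by have [_ []] := cP i.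
  by have [v iv [Wv vc]] := nbhs_isolated _ _ nWc; exists v.
apply: (@punctured_power_pieces x a c) => [i k|i|i|i k|i].
- by have [/(_ k)[]] := aP i.
- by have [] := cP i.
- by have [] := aP i.
- by have [/(_ k)[]] := aP i.
- by have [_ cx] := cP i; move=> /esym.
Qed.

(** * Non-reconstructibility *)

Hypothesis X_compact : compact [set: X].

(** The sum [nat * Y] of countably many copies has the deck of [Y] and is not
    compact. *)
Lemma non_reconstructible_power (p q : X) :
  p <> q -> ~ reconstructible {ptws nat -> X}.
Proof.
move=> pq /(_ (nat * {ptws nat -> X})%type) rec.
have homE (S T : topologicalType) : homeomorphic S T ->
    homeo_class S = homeo_class T.
  move=> ST; apply/funext => V; apply/propext; split => VS.
    exact: homeomorphic_trans ST.
  exact: homeomorphic_trans (homeomorphic_sym _ _ ST).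
have [|f [g [fK gK cf cg]]] := rec.
  apply/funext => C; apply/propext; split=> [[[n x] ->]|[x ->]].
    by exists x; apply/esym/homE; exact: punctured_power_absorbs_copies pq.
  by exists (0, x); apply: homE; exact: punctured_power_absorbs_copies pq.
apply: not_compact_nat.
have cY : compact [set: {ptws nat -> X}].
  have := @tychonoff nat (fun=> X) (fun=> setT) (fun=> X_compact).
  by congr compact; apply/seteqP; split.
rewrite (_ : [set: nat] = (fst \o g) @` setT).
  apply: continuous_compact cY; apply: continuous_subspaceT => x.
  by apply: continuous_comp; [exact: cg|exact: cvg_fst].
apply/seteqP; split=> // n _; exists (f (n, fun=> p)) => //=.
by rewrite fK.
Qed.

End Words.

(* {ptws nat -> X} is the countable power of X with the product topology.
   Non-reconstructibility needs two points: the empty space and the one-point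
   space are reconstructible and equal to their own countable power. *)
Theorem corollary6p5 (X : topologicalType)
    (X_fc : first_countable X)
    (X_compact : compact [set: X])
    (X_hausdorff : hausdorff_space X)
    (X_isolated : dense (isolated [set: X])) :
  h_homogeneous {ptws nat -> X} /\
  ((exists x y : X, x <> y) -> ~ reconstructible {ptws nat -> X}).
Proof.
split; first exact: h_homogeneous_power.
by move=> [p [q pq]]; exact: non_reconstructible_power pq.
Qed.
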